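(* There exist uncountably many pairwise non-similar nondegenerate tetrahedra in $\mathbb R^3$, each of which has an infinite degenerating LEB branch $(\Delta_n)_{n\ge0}$ such that every tetrahedron $\Delta_n$ in the branch has a unique longest edge (so the branch is independent of any tie-breaking rule).
   Context: A nondegenerate tetrahedron is given by four affinely independent points of $\mathbb R^3$; two tetrahedra are similar if some Euclidean similarity maps the vertex set of one onto the vertex set of the other. Bisecting a tetrahedron at an edge $p_ip_j$ produces two children: one in which $p_i$ is replaced by the midpoint $\tfrac12(p_i+p_j)$ and one in which $p_j$ is replaced by it, the other vertices being unchanged. An LEB (Longest Edge Bisection) branch of $\Delta$ is a sequence $(\Delta_n)_{n\ge0}$ with $\Delta_0=\Delta$ such that, for each $n$, $\Delta_{n+1}$ is one of the two children obtained by bisecting $\Delta_n$ at some longest edge of $\Delta_n$. Put $\vartheta(\Delta)=\operatorname{vol}(\Delta)/\operatorname{diam}(\Delta)^3$. The branch degenerates if $\vartheta(\Delta_n)\to0$ as $n\to\infty$. *)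

(* Defs.v *)
From mathcomp Require Import all_boot all_order all_algebra.
From mathcomp Require Import all_classical all_reals all_analysis.

Set Implicit Arguments.
Unset Strict Implicit.
Unset Printing Implicit Defensive.

Import Order.TTheory GRing.Theory Num.Theory.
Import numFieldNormedType.Exports.

Local Open Scope classical_set_scope.
Local Open Scope ring_scope.

(* The library norm on ['rV[R]_n] is the sup norm, hence this definition. *)
Definition edist (R : realType) (n : nat) (x y : 'rV[R]_n) : R :=
  Num.sqrt (\sum_(k < n) (x 0 k - y 0 k) ^+ 2).

(* A labelled family of four points, possibly degenerate. *)
Definition tetrahedron (R : realType) : Type := 'I_4 -> 'rV[R]_3.

Definition affinely_independent (R : realType) (m n : nat)
    (p : 'I_m -> 'rV[R]_n) : Prop :=
  forall c : 'I_m -> R,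
    \sum_(i < m) c i = 0 -> \sum_(i < m) c i *: p i = 0 -> forall i, c i = 0.

Definition nondegenerate_tetrahedron (R : realType)
    (T : tetrahedron R) : Prop :=
  affinely_independent T.

Definition similarity (R : realType) (n : nat)
    (f : 'rV[R]_n -> 'rV[R]_n) : Prop :=
  exists2 r : R, 0 < r & forall x y, edist (f x) (f y) = r * edist x y.

(* [range T] is the vertex set, so the labelling plays no role here. *)
Definition similar_tetrahedra (R : realType)
    (T1 T2 : tetrahedron R) : Prop :=
  exists2 f : 'rV[R]_3 -> 'rV[R]_3, similarity f & f @` range T1 = range T2.

Definition longest_edge (R : realType) (T : tetrahedron R) (i j : 'I_4) : Prop :=
  i != j /\ forall k l : 'I_4, edist (T k) (T l) <= edist (T i) (T j).

(* Edges are unordered, whence the two alternatives. *)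
Definition has_unique_longest_edge (R : realType) (T : tetrahedron R) : Prop :=
  exists i j : 'I_4, longest_edge T i j /\
    forall k l : 'I_4, longest_edge T k l ->
      (k = i /\ l = j) \/ (k = j /\ l = i).

(* The child in which vertex [i] is replaced by the midpoint of edge [i j];
   the other child of this edge is [bisect T j i]. *)
Definition bisect (R : realType) (T : tetrahedron R) (i j : 'I_4) :
    tetrahedron R :=
  fun k => if k == i then 2^-1 *: (T i + T j) else T k.

Definition LEB_child (R : realType) (T T' : tetrahedron R) : Prop :=
  exists i j : 'I_4,
    longest_edge T i j /\ (T' = bisect T i j \/ T' = bisect T j i).

Definition LEB_branch (R : realType) (T : tetrahedron R)
    (D : nat -> tetrahedron R) : Prop :=
  D 0%N = T /\ forall n, LEB_child (D n) (D n.+1).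

Definition solid (R : realType) (T : tetrahedron R) : set 'rV[R]_3 :=
  [set x | exists w : 'I_4 -> R,
    [/\ forall i, 0 <= w i, \sum_(i < 4) w i = 1 & x = \sum_(i < 4) w i *: T i]].

Definition diam (R : realType) (T : tetrahedron R) : R :=
  sup [set d | exists x y, [/\ solid T x, solid T y & d = edist x y]].

(* One sixth of the parallelepiped spanned by the edges at vertex 0. *)
Definition vol (R : realType) (T : tetrahedron R) : R :=
  `| \det (\matrix_(i < 3) (T (lift ord0 i) - T ord0)) | / 6.

Definition vartheta (R : realType) (T : tetrahedron R) : R :=
  vol T / diam T ^+ 3.

Definition degenerates (R : realType) (D : nat -> tetrahedron R) : Prop :=
  (fun n => vartheta (D n)) @ \oo --> (0 : R).

(* Main.v *)
From Stdlib Require Import BinInt.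
Require Import Defs.
From mathcomp Require Import all_boot all_order all_algebra.
From mathcomp Require Import all_classical all_reals all_analysis.
From mathcomp Require Import ring lra ssrZ.

(**
The squared edge lengths of a tetrahedron evolve linearly under bisection: if
[m] is the midpoint of [p q] then [|m r|^2 = (|p r|^2 + |q r|^2)/2 - |p q|^2/4].
Hence for the tetrahedra [T_u] with vertices [(0,0,0)], [(3,√7,2u)],
[(2,-2√7,3u)], [(8,0,0)] every squared edge length that occurs has the form
[a + u^2 h], where the planar part [a] (from the first two coordinates) and the
height part [h] are rational and independent of [u].  There is a word of 54
bisections which multiplies all planar parts by [2^-34] and all height parts by
[2^-40].  The bisected edge has maximal planar part at each step; the frequent
ties among planar parts are resolved strictly by the height parts, so the edge
is the unique longest one for [0 < u <= 1].  One period replaces [u^2] by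
[u^2/64], which preserves this range, and the word can be repeated forever.  In
each period the volume gains a factor [2^-54], but the cube of the diameter only
[2^-51]: the branch flattens onto a plane.  The ratio of the extreme edge
lengths of [T_u] determines [u], so the [T_u] are pairwise non-similar.
*)

Set Implicit Arguments.
Unset Strict Implicit.
Unset Printing Implicit Defensive.

Import Order.TTheory GRing.Theory Num.Theory.
Import numFieldNormedType.Exports.

Local Open Scope classical_set_scope.
Local Open Scope ring_scope.

(** * Integer tables of squared edge lengths and the bisection word *)

Definition sqdist (R : realType) n (x y : 'rV[R]_n) : R :=
  \sum_(k < n) (x 0 k - y 0 k) ^+ 2.

Definition entry (t : seq (seq Z)) (i j : nat) : Z := nth 0 (nth [::] t i) j.

(** The midpoint identity multiplied by 4. It is linear, so planar and height parts can be bisected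
    separately. *)
Definition bisect_table (i j : nat) (t : seq (seq Z)) : seq (seq Z) :=
  mkseq (fun k => mkseq (fun l =>
    if k == l then 0
    else if k == i then 2 * entry t i l + 2 * entry t j l - entry t i j
    else if l == i then 2 * entry t k i + 2 * entry t k j - entry t i j
    else 4 * entry t k l) 4) 4.

Definition bisect_tables (p : nat * nat) (s : seq (seq Z) * seq (seq Z)) :=
  (bisect_table p.1 p.2 s.1, bisect_table p.1 p.2 s.2).

(* [planar_table] and [height_table] hold the parts [a] and [h] of the squared
   edge lengths [a + u ^+ 2 * h] of [family_tetrahedron u] below.  The entries
   are rescaled by 4 at each bisection in order to stay integral. *)
Definition planar_table : seq (seq Z) :=
  [:: [:: 0; 16; 32; 64]; [:: 16; 0; 64; 32];
      [:: 32; 64; 0; 64]; [:: 64; 32; 64; 0]].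

Definition height_table : seq (seq Z) :=
  [:: [:: 0; 4; 9; 0]; [:: 4; 0; 1; 4];
      [:: 9; 1; 0; 9]; [:: 0; 4; 9; 0]].

Definition base_tables := (planar_table, height_table).

(* Each pair [(i, j)] stands for the bisection of the edge [i j] that moves the
   vertex [i].  The word was found by computer search; after its first half the
   shape recurs up to [swap_label]. *)
Definition half_word : seq (nat * nat) :=
  [:: (3,2); (2,1); (0,3); (3,1); (0,1); (1,2); (0,2); (2,3); (1,3); (3,0);
      (2,1); (1,0); (2,0); (0,3); (2,3); (3,1); (0,1); (1,2); (0,3); (1,2);
      (3,2); (2,0); (0,3); (1,3); (3,2); (1,0); (0,2)]%N.

Definition swap_label (i : nat) : nat := nth 0%N [:: 1; 0; 3; 2]%N i.

(** [swap_label] is an involution, so the relabelled second half restores the labels. *)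
Definition cyclic_word :=
  half_word ++ [seq (swap_label p.1, swap_label p.2) | p <- half_word].

(* With [a] and [h] the gaps between the edge [p] and a competing edge, the last
   clause makes [a + t * h] positive for all [0 < t <= 1].  The bound [b], which
   [admissible_word] multiplies by 4 at each step, keeps the bisected edges from
   shrinking too fast. *)
Definition admissible_edge (s : seq (seq Z) * seq (seq Z)) (b : Z)
    (p : nat * nat) : bool :=
  let a k l := entry s.1 p.1 p.2 - entry s.1 k l in
  let h k l := entry s.2 p.1 p.2 - entry s.2 k l in
  [&& (p.1 < 4)%N, (p.2 < 4)%N, p.1 != p.2, b <= 2 ^+ 34 * entry s.1 p.1 p.2,
     0 <= entry s.2 p.1 p.2
   & all (fun k => all (fun l =>
       [|| k == l, (k == p.1) && (l == p.2), (k == p.2) && (l == p.1)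
        | (0 <= a k l) && (0 < a k l + h k l)]) (iota 0 4)) (iota 0 4)].

Fixpoint admissible_word (s : seq (seq Z) * seq (seq Z)) (b : Z)
    (w : seq (nat * nat)) : bool :=
  if w is p :: w' then
    admissible_edge s b p && admissible_word (bisect_tables p s) (4 * b)%R w'
  else true.

Lemma admissible_word_cons s b p w : admissible_word s b (p :: w) =
  admissible_edge s b p && admissible_word (bisect_tables p s) (4 * b)%R w.
Proof. by []. Qed.

Lemma cyclic_word_admissible : admissible_word base_tables 1 cyclic_word.
Proof. by vm_compute. Qed.

(** The 54 rescalings contribute [4 ^ 54 = 2 ^ 108]; the exponents are [108 - 34] and [108 - 40]. *)
Lemma cyclic_word_scaling (k l : 'I_4) :
  let s := foldl (fun t p => bisect_tables p t) base_tables cyclic_word in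
  entry s.1 k l = 2 ^+ 74 * entry planar_table k l /\
  entry s.2 k l = 2 ^+ 68 * entry height_table k l.
Proof.
move=> s.
have : all (fun k => all (fun l =>
    (entry s.1 k l == 2 ^+ 74 * entry planar_table k l) &&
    (entry s.2 k l == 2 ^+ 68 * entry height_table k l)) (iota 0 4)) (iota 0 4).
  by vm_compute.
move=> /allP/(_ (val k)); rewrite mem_iota ltn_ord => /(_ isT).
move=> /allP/(_ (val l)); rewrite mem_iota ltn_ord => /(_ isT).
by case/andP => /eqP ? /eqP ?; split.
Qed.

(** * From integer tables to real squared distances *)

Local Notation "z %:ZR" := ((int_of_Z z)%:~R) (at level 2, format "z %:ZR").

Lemma ZR_ge0 (R : realType) (z : Z) : 0 <= z -> 0 <= z%:ZR :> R.
Proof. by case: z => [|p|p] //= _; rewrite ler0z. Qed.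

Lemma ZR_gt0 (R : realType) (z : Z) : 0 < z -> 0 < z%:ZR :> R.
Proof.
move=> z0; rewrite lt_neqAle ZR_ge0 ?ltW// andbT eq_sym intr_eq0.
by rewrite -[0]/(int_of_Z 0) (can_eq int_of_ZK) gt_eqF.
Qed.

Section Tables.
Variable R : realType.
Implicit Types (T : tetrahedron R) (c t : R).

Lemma sqdistC n (x y : 'rV[R]_n) : sqdist x y = sqdist y x.
Proof. by apply: eq_bigr => k _; rewrite -sqrrN opprB. Qed.

Lemma sqdistxx n (x : 'rV[R]_n) : sqdist x x = 0.
Proof. by apply: big1 => k _; rewrite subrr expr0n. Qed.

Lemma sqdist_ge0 n (x y : 'rV[R]_n) : 0 <= sqdist x y.
Proof. by apply: sumr_ge0 => k _; exact: sqr_ge0. Qed.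

Lemma sqdist_midpoint n (x y z : 'rV[R]_n) :
  sqdist (2^-1 *: (x + y)) z =
  (2 * sqdist x z + 2 * sqdist y z - sqdist x y) / 4.
Proof.
rewrite /sqdist !mulr_sumr -big_split -sumrB mulr_suml /=.
by apply: eq_bigr => k _; rewrite !mxE; field.
Qed.

(** [c] is the overall scale and [t] the squared height parameter; a whole period changes only these
    two. *)
Definition has_tables T c t (s : seq (seq Z) * seq (seq Z)) :=
  forall k l : 'I_4, sqdist (T k) (T l) =
    c * ((entry s.1 k l)%:ZR + t * (entry s.2 k l)%:ZR).

Lemma has_tables_bisect T c t s (i j : 'I_4) : has_tables T c t s ->
  has_tables (bisect T i j) (c / 4) t (bisect_tables (i : nat, j : nat) s).
Proof.
move=> hT k l; rewrite /bisect /entry /= !nth_mkseq ?ltn_ord //.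
rewrite !val_eqE; case: (eqVneq k l) => [->|kl].
  by rewrite sqdistxx !rmorph0 mulr0 addr0 mulr0.
case: (eqVneq k i) => [ki|ki].
  have li : l != i by rewrite -ki eq_sym.
  rewrite (negbTE li) sqdist_midpoint !hT !(rmorph_nat, rmorphB, rmorphD, rmorphM) /=.
  by field.
case: (eqVneq l i) => [li|li].
  rewrite sqdistC sqdist_midpoint (sqdistC (T i) (T k)) (sqdistC (T j) (T k)).
  by rewrite !hT !(rmorph_nat, rmorphB, rmorphD, rmorphM) /=; field.
by rewrite hT !(rmorph_nat, rmorphM) /=; field.
Qed.

Definition bisect_step T (p : nat * nat) : tetrahedron R :=
  bisect T (inord p.1) (inord p.2).

Lemma has_tables_step T c t s p : (p.1 < 4)%N -> (p.2 < 4)%N ->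
  has_tables T c t s ->
  has_tables (bisect_step T p) (c / 4) t (bisect_tables p s).
Proof.
move=> p1 p2 /(@has_tables_bisect _ _ _ _ (inord p.1) (inord p.2)).
by rewrite !inordK // -surjective_pairing.
Qed.

Lemma has_tables_run w T c t s b : admissible_word s b w -> has_tables T c t s ->
  has_tables (foldl bisect_step T w) (c / 4 ^+ size w) t
    (foldl (fun s p => bisect_tables p s) s w).
Proof.
elim: w T c s b => [|p w IH] T c s b /=; first by rewrite expr0 divr1.
case/andP => /and5P[p1 p2 _ _ _] hw hT.
by rewrite exprS invfM mulrA; apply: IH hw _; exact: has_tables_step.
Qed.

Lemma admissible_edge_run w T c t s b r :
    admissible_word s b w -> has_tables T c t s -> (r < size w)%N ->
  exists s', admissible_edge s' (4 ^+ r * b)%R (nth (0, 0)%N w r) /\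
    has_tables (foldl bisect_step T (take r w)) (c / 4 ^+ r) t s'.
Proof.
elim: w T c s b r => [//|p w IH] T c s b r; rewrite admissible_word_cons.
case/andP => hp hw hT; case: r => [_|r rw].
  by exists s; rewrite !expr0 mul1r divr1.
have [p1 p2 _ _ _] := and5P hp.
have [s' [h1 h2]] := IH _ _ _ _ _ hw (has_tables_step p1 p2 hT) rw.
exists s'; split; first by rewrite exprSr -mulrA.
by rewrite exprS invfM mulrA.
Qed.
End Tables.

(** * Unique longest edges and the periodic branch *)

Section Branch.
Variable R : realType.
Implicit Types (T : tetrahedron R) (c t : R).

Lemma admissible_edge_longest T c t s b p :
    0 < c -> 0 < t <= 1 -> admissible_edge s b p -> has_tables T c t s ->
  let i := inord p.1 : 'I_4 in let j := inord p.2 : 'I_4 in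
  [/\ i != j,
      c * b%:ZR <= 2 ^+ 34 * sqdist (T i) (T j)
    & forall k l : 'I_4, k != l -> ~ (k = i /\ l = j) -> ~ (k = j /\ l = i) ->
        sqdist (T k) (T l) < sqdist (T i) (T j)].
Proof.
move=> c0 /andP[t0 t1] /and5P[p1 p2 p12 hb /andP[hge0 hall]] hT i j.
have vi : i = p.1 :> nat by rewrite inordK.
have vj : j = p.2 :> nat by rewrite inordK.
have ij : i != j by rewrite -val_eqE /= vi vj.
split=> //.
  rewrite hT vi vj [2 ^+ 34 * _]mulrCA ler_pM2l// mulrDr.
  have := @ZR_ge0 R _ (eq_ind_r is_true hb (subr_ge0 _ _)).
  rewrite !(rmorph_nat, rmorphB, rmorphM, rmorphXn) /= => h1.
  have := @ZR_ge0 R _ hge0 => h2.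
  have : 0 <= 2 ^+ 34 * (t * (entry s.2 p.1 p.2)%:ZR) :> R.
    by rewrite !mulr_ge0 // ltW.
  lra.
move=> k l kl nij nji.
move: hall => /allP/(_ (k : nat)); rewrite mem_iota ltn_ord => /(_ isT).
move=> /allP/(_ (l : nat)); rewrite mem_iota ltn_ord => /(_ isT).
rewrite -vi -vj !val_eqE (negbTE kl) /=.
case/or3P => [/andP[/eqP ? /eqP ?]|/andP[/eqP ? /eqP ?]|/andP[ha hah]].
- by case: nij.
- by case: nji.
rewrite !hT ltr_pM2l// -subr_gt0.
have := @ZR_ge0 R _ ha; have := @ZR_gt0 R _ hah.
rewrite !(rmorphB, rmorphD) /= => h1 h2.
have t1' : 0 <= 1 - t by rewrite subr_ge0.
(* affine in [t]: nonnegative at [0] and positive at [1] *)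
have := ltr_wpDl (mulr_ge0 t1' h2) (mulr_gt0 t0 h1).
by congr (_ < _); ring.
Qed.

Lemma admissible_edge_unique c t s b p T :
    0 < c -> 0 < t <= 1 -> admissible_edge s b p -> has_tables T c t s ->
  longest_edge T (inord p.1) (inord p.2) /\ has_unique_longest_edge T.
Proof.
move=> c0 t01 hp hT; have [] := admissible_edge_longest c0 t01 hp hT.
set i := inord p.1; set j := inord p.2 => ij _ lt_ij.
have le_ij k l : sqdist (T k) (T l) <= sqdist (T i) (T j).
  have [->|kl] := eqVneq k l; first by rewrite sqdistxx sqdist_ge0.
  have [[-> ->]//|n1] := pselect (k = i /\ l = j).
  have [[-> ->]|n2] := pselect (k = j /\ l = i); first by rewrite (sqdistC (T j)).
  exact/ltW/lt_ij.
(* A bare [edist] would be the extended distance of the analysis library. *)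
have lij : longest_edge T i j.
  by split=> // k l; rewrite /Defs.edist ler_wsqrtr //; exact: le_ij.
split=> //; exists i, j; split=> // k l [kl /(_ i j) le_kl].
apply: contrapT => /not_orP[n1 n2].
have := lt_ij _ _ kl n1 n2; rewrite ltNge => /negP; apply.
by rewrite -ler_sqrt ?sqdist_ge0.
Qed.

Fixpoint branch T n : tetrahedron R :=
  if n is m.+1 then
    bisect_step (branch T m) (nth (0, 0)%N cyclic_word (m %% size cyclic_word))
  else T.

Lemma branch_period T m r : (r <= size cyclic_word)%N ->
  branch T (m * size cyclic_word + r) =
  foldl (@bisect_step R) (branch T (m * size cyclic_word)) (take r cyclic_word).
Proof.
elim: r => [|r IH] hr; first by rewrite addn0 take0.
rewrite addnS (take_nth (0, 0)%N hr) foldl_rcons -IH; last exact: ltnW.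
by rewrite [LHS]/= modnMDl modn_small.
Qed.

(** Over a period the height entries gain [2 ^ 6] less than the planar ones, which divides [t] by
    64. *)
Lemma has_tables_branch T t m : has_tables T 1 t base_tables ->
  has_tables (branch T (m * size cyclic_word)) (2 ^- 34 ^+ m) (t / 64 ^+ m)
    base_tables.
Proof.
move=> hT; elim: m => [|m IH]; first by rewrite mul0n expr0 divr1.
rewrite mulSn addnC branch_period// take_size => k l.
rewrite (has_tables_run cyclic_word_admissible IH).
have [-> ->] := cyclic_word_scaling k l.
rewrite !(rmorph_nat, rmorphM, rmorphXn) /=.
have -> : 4 ^+ size cyclic_word = 2 ^+ 34 * 64 * 2 ^+ 68 :> R.
  have -> : (4 : R) = 2 ^+ 2 by ring.
  have -> : (64 : R) = 2 ^+ 6 by ring.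
  by rewrite -exprM -!exprD.
have -> : 2 ^+ 74 = 64 * 2 ^+ 68 :> R.
  have -> : (64 : R) = 2 ^+ 6 by ring.
  by rewrite -exprD.
rewrite (exprS _ m) (exprS 64 m).
have h34 : 2 ^+ 34 != 0 :> R by rewrite expf_neq0// pnatr_eq0.
have h68 : 2 ^+ 68 != 0 :> R by rewrite expf_neq0// pnatr_eq0.
have h64 : 64 ^+ m != 0 :> R by rewrite expf_neq0// pnatr_eq0.
have h6 : 64 != 0 :> R by rewrite pnatr_eq0.
move: h34 h68 h64 h6; rewrite !exprVn.
move: (2 ^+ 34 : R) (2 ^+ 68 : R) (64 ^+ m : R) (64 : R) => x y z w x0 y0 z0 w0.
by field; rewrite x0 y0 z0 w0 expf_neq0.
Qed.

End Branch.

(** * Volume under bisection and bounds on [vartheta] *)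

Section Volume.
Variable R : realType.
Implicit Types (T : tetrahedron R).

(** Homogeneous coordinates treat the four vertices alike, so bisection changes a single row. *)
Definition homogeneous_mx T : 'M[R]_(1 + 3) :=
  row_mx (const_mx 1 : 'cV_(1 + 3)) (\matrix_i T i).

Lemma vol_homogeneous T : vol T = `|\det (homogeneous_mx T)| / 6.
Proof.
rewrite /vol; congr (`| _ | / _).
set E := \matrix_i _.
(* The left factor, of determinant 1, adds the row of vertex 0 to the other rows. *)
have -> : homogeneous_mx T =
    block_mx 1%:M 0 (const_mx 1) 1%:M *m block_mx 1%:M (T ord0) 0 E.
  rewrite mulmx_block !(mul1mx, mul0mx, mulmx1, mulmx0, addr0).
  apply/matrixP => i k.
  have l0 : lshift 3 (0 : 'I_1) = ord0 by exact: val_inj.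
  case: (split_ordP i) => {}i ->; case: (split_ordP k) => {}k ->.
  - by rewrite row_mxEl block_mxEul !mxE !ord1.
  - by rewrite row_mxEr block_mxEur !mxE ord1 l0.
  - by rewrite row_mxEl block_mxEdl !mxE.
  - rewrite row_mxEr block_mxEdr !mxE big_ord1 mxE mul1r addrC subrK.
    by congr (T _ _ _); exact: val_inj.
by rewrite det_mulmx det_lblock det_ublock !det1 !mul1r.
Qed.

Lemma vol_bisect T (i j : 'I_4) : i != j -> vol (bisect T i j) = vol T / 2.
Proof.
move=> ij; rewrite !vol_homogeneous.
have -> : \det (homogeneous_mx (bisect T i j)) = 2^-1 * \det (homogeneous_mx T).
  (* Row [i] of the child is half the sum of rows [i] and [j]; the summand with row [j] twice has
     determinant 0. *)
  pose C := \matrix_k (if k == i then row j (homogeneous_mx T)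
                       else row k (homogeneous_mx T)).
  have C0 : \det C = 0.
    apply: (determinant_alternate ij) => k.
    by rewrite !mxE eqxx eq_sym (negbTE ij) !mxE.
  rewrite (@determinant_multilinear _ _ _ (homogeneous_mx T) C i 2^-1 2^-1).
  - by rewrite C0 mulr0 addr0.
  - apply/rowP => k; rewrite !mxE eqxx !mxE /bisect.
    by case: splitP => k' _; rewrite !mxE ?eqxx ?mxE; field.
  - apply/matrixP => a k; rewrite !mxE /bisect.
    by case: splitP => k' _; rewrite !mxE // eq_sym (negbTE (neq_lift _ _)).
  - apply/matrixP => a k; rewrite !mxE /bisect eq_sym (negbTE (neq_lift _ _)) !mxE.
    by case: splitP => k' _; rewrite !mxE // eq_sym (negbTE (neq_lift _ _)).
by rewrite normrM ger0_norm ?invr_ge0//; field.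
Qed.

Lemma solid_vertex T k : solid T (T k).
Proof.
exists (fun l => (l == k)%:R); split=> [l||].
- exact: ler0n.
- by rewrite (bigD1 k) //= eqxx big1 ?addr0 // => l /negbTE ->.
- rewrite (bigD1 k) //= eqxx scale1r big1 ?addr0 // => l /negbTE ->.
  by rewrite scale0r.
Qed.

(* A set without supremum has [sup] equal to [0], so that boundedness of
   [solid T] is not needed. *)
Lemma diam_edge T (i j : 'I_4) : diam T = 0 \/ Defs.edist (T i) (T j) <= diam T.
Proof.
rewrite /diam; set E := [set d | _].
have [hE|/sup_out ->] := pselect (has_sup E); last by left.
by right; apply: sup_upper_bound => //; exists (T i), (T j);
  split=> //; exact: solid_vertex.
Qed.

Lemma vol_ge0 T : 0 <= vol T.
Proof. by rewrite divr_ge0. Qed.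

Lemma vartheta_ge0 T : 0 <= vartheta T.
Proof.
rewrite divr_ge0 ?vol_ge0 ?exprn_ge0 //.
by have [->//|] := diam_edge T ord0 ord0; apply: le_trans; exact: sqrtr_ge0.
Qed.

Lemma vartheta_le_edge T (i j : 'I_4) (a : R) : 0 < a ->
  a <= Defs.edist (T i) (T j) -> vartheta T <= vol T / a ^+ 3.
Proof.
(* If [diam T = 0], division by zero makes [vartheta T] vanish. *)
move=> a0 ae; rewrite /vartheta; have [->|le_diam] := diam_edge T i j.
  by rewrite expr0n /= invr0 mulr0 divr_ge0 ?vol_ge0 // exprn_ge0 // ltW.
have ad := le_trans ae le_diam.
have d0 := lt_le_trans a0 ad.
rewrite ler_wpM2l ?vol_ge0 // lef_pV2 ?posrE ?exprn_gt0 //.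
by rewrite lerXn2r ?nnegrE ?(ltW a0) ?(ltW d0).
Qed.

End Volume.

(** * The branch is an LEB branch and degenerates *)

Section BranchProperties.
Variable R : realType.
Variables (T : tetrahedron R) (t : R).
Hypotheses (t01 : 0 < t <= 1) (hT : has_tables T 1 t base_tables).

(** At each step [b] is multiplied and [c] divided by 4, so [c * b] stays constant throughout a
    period. *)
Lemma branch_edge n : exists (c : R) s b,
  let p := nth (0, 0)%N cyclic_word (n %% size cyclic_word) in
  [/\ 0 < c, exists2 t' : R, 0 < t' <= 1 & has_tables (branch T n) c t' s,
      admissible_edge s b p
    & c * b%:ZR = 2 ^- 34 ^+ (n %/ size cyclic_word) :> R].
Proof.
set L := size cyclic_word; set m := (n %/ L)%N; set r := (n %% L)%N.
have rL : (r < L)%N by rewrite ltn_mod.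
have [s [hs hr]] := admissible_edge_run cyclic_word_admissible
  (has_tables_branch m hT) rL.
rewrite -branch_period ?(ltnW rL)// -divn_eq in hr.
exists (2 ^- 34 ^+ m / 4 ^+ r), s, (4 ^+ r * 1).
have [t0 t1] := andP t01.
split=> [||//|].
- by rewrite divr_gt0 ?exprn_gt0 ?invr_gt0 ?exprn_gt0.
- exists (t / 64 ^+ m) => //; rewrite divr_gt0 ?exprn_gt0//=.
  rewrite ler_pdivrMr ?exprn_gt0// mul1r (le_trans t1)//.
  by rewrite exprn_ege1// ler1n.
- by rewrite mulr1 rmorphXn rmorph_nat rmorphXn /= mulfVK.
Qed.

Lemma branch_LEB : LEB_branch T (branch T).
Proof.
split=> // n; have [c [s [b [c0 [t' ht' h] hp _]]]] := branch_edge n.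
have [hl _] := admissible_edge_unique c0 ht' hp h.
by exists (inord (nth (0, 0)%N cyclic_word (n %% size cyclic_word)).1),
  (inord (nth (0, 0)%N cyclic_word (n %% size cyclic_word)).2); split=> //; left.
Qed.

Lemma branch_unique n : has_unique_longest_edge (branch T n).
Proof.
have [c [s [b [c0 [t' ht' h] hp _]]]] := branch_edge n.
by have [] := admissible_edge_unique c0 ht' hp h.
Qed.

Lemma vol_branch n : vol (branch T n) = vol T / 2 ^+ n.
Proof.
elim: n => [|n IH]; first by rewrite expr0 divr1.
have [c [s [b [c0 [t' ht' h] hp _]]]] := branch_edge n.
have [ij _ _] := admissible_edge_longest c0 ht' hp h.
by rewrite /= vol_bisect// IH exprSr invfM mulrA.
Qed.

(** After [m] full periods the volume is at most [vol T * 2 ^ (- 54 m)], while the bisected edge has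
    length at least [2 ^ (- 17 (m + 1))]. *)
Lemma vartheta_branch_le n :
  vartheta (branch T n) <= vol T * 2 ^+ 51 / 8 ^+ (n %/ size cyclic_word).
Proof.
have [c [s [b [c0 [t' ht' h] hp hb]]]] := branch_edge n.
have [ij + _] := admissible_edge_longest c0 ht' hp h.
rewrite hb; set i := inord _; set j := inord _; set m := (n %/ _)%N => hL.
have two0 k : 2 ^+ k != 0 :> R by rewrite expf_neq0// pnatr_eq0.
have hsq : (2 ^- 17 ^+ m.+1) ^+ 2 <= sqdist (branch T n i) (branch T n j).
  rewrite -(ler_pM2l (_ : 0 < 2 ^+ 34)) ?exprn_gt0//; apply: le_trans hL.
  rewrite -exprM mulnC exprM exprVn -exprM (exprS _ m).
  by rewrite mulrA mulfV// mul1r.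
have a0 : 0 < 2 ^- 17 ^+ m.+1 :> R by rewrite exprn_gt0// invr_gt0 exprn_gt0.
have hle : 2 ^- 17 ^+ m.+1 <= Defs.edist (branch T n i) (branch T n j).
  by rewrite -[leLHS]ger0_norm ?(ltW a0)// -sqrtr_sqr; exact: ler_wsqrtr.
apply: le_trans (vartheta_le_edge a0 hle) _.
rewrite vol_branch -!(mulrA (vol T)) ler_wpM2l ?vol_ge0//.
have -> : (2 ^- 17 ^+ m.+1) ^+ 3 = 2 ^- (51 + 51 * m) :> R.
  by rewrite -exprM exprVn -exprM -mulnS [(m.+1 * _)%N]mulnC mulnA.
rewrite invrK; have -> : 8 ^+ m = 2 ^+ (3 * m) :> R.
  by rewrite exprM; congr (_ ^+ m); ring.
rewrite mulrC ler_pdivlMr ?exprn_gt0// mulrAC ler_pdivrMr ?exprn_gt0//.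
rewrite -!exprD ler_weXn2l ?ler1n// -addnA leq_add2l -mulnDl mulnC.
exact: leq_trunc_div.
Qed.

Lemma branch_degenerates : degenerates (branch T).
Proof.
set V := vol T * 2 ^+ 51.
have V0 : 0 <= V by rewrite mulr_ge0 ?vol_ge0.
(* With [m = n %/ 54], one has [n + 1 <= 54 (m + 1) <= 54 * 8 ^ m]. *)
apply: (@squeeze_cvgr _ _ _ _ (fun=> 0) (fun n => V * 54 * harmonic n)).
- apply: nearW => n; apply/andP; split; first exact: vartheta_ge0.
  apply: le_trans (vartheta_branch_le n) _.
  rewrite -(mulrA V) ler_wpM2l// ler_pdivlMr// mulrC ler_pdivrMr ?exprn_gt0//.
  rewrite -natrX -natrM ler_nat (leq_trans (ltn_ceil n (isT : 0 < 54)%N))//.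
  by rewrite mulnC leq_mul2l ltn_expl.
- exact: cvg_cst.
- rewrite -[X in _ --> X](mulr0 (V * 54)); apply: cvgM; first exact: cvg_cst.
  exact: cvg_harmonic.
Qed.
End BranchProperties.

(** * The family: nondegenerate, pairwise non-similar, uncountable *)

Section Family.
Variable R : realType.
Implicit Types (u : R).

Definition family_tetrahedron u : tetrahedron R := fun i =>
  \row_k nth 0 (nth [::]
    [:: [:: 0; 0; 0]; [:: 3; Num.sqrt 7; 2 * u];
        [:: 2; - 2 * Num.sqrt 7; 3 * u]; [:: 8; 0; 0]] i) k.

Lemma pos_literalE :
  ((Pos.to_nat 1 = 1%N) * (Pos.to_nat 4 = 4%N) * (Pos.to_nat 9 = 9%N) *
   (Pos.to_nat 16 = 16%N) * (Pos.to_nat 32 = 32%N) * (Pos.to_nat 64 = 64%N))%type.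
Proof. by []. Qed.

Lemma family_has_tables u :
  has_tables (family_tetrahedron u) 1 (u ^+ 2) base_tables.
Proof.
have s7 : Num.sqrt 7 ^+ 2 = 7 :> R by rewrite sqr_sqrtr.
move=> k l; rewrite /sqdist !big_ord_recl big_ord0 !mxE /=.
move: s7; set s := Num.sqrt 7 => s7.
case: k => [[|[|[|[|//]]]] /= ?]; case: l => [[|[|[|[|//]]]] /= ?];
  rewrite /entry /= -?[(Pos.to_nat _)%:~R]/(_%:R) ?pos_literalE; ring: s7.
Qed.

Lemma family_nondegenerate u : 0 < u -> nondegenerate_tetrahedron (family_tetrahedron u).
Proof.
move=> u0 c; rewrite !big_ord_recl !big_ord0 !addr0 => sum_c comb.
have s7 : 0 < Num.sqrt 7 :> R by rewrite sqrtr_gt0.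
have := congr1 (fun v : 'rV_3 => v 0 0) comb.
have := congr1 (fun v : 'rV_3 => v 0 1) comb.
have := congr1 (fun v : 'rV_3 => v 0 2%:R) comb.
rewrite !mxE /=.
move: sum_c.
set c0 := c _; set c1 := c _; set c2 := c _; set c3 := c _ => sum_c e2 e1 e0.
have h1 : Num.sqrt 7 * (c1 - 2 * c2) = 0 by lra.
have h2 : u * (2 * c1 + 3 * c2) = 0 by lra.
move/eqP: h1; rewrite mulf_eq0 gt_eqF //= => /eqP h1.
move/eqP: h2; rewrite mulf_eq0 gt_eqF //= => /eqP h2.
have [z0 z1 z2 z3] : [/\ c0 = 0, c1 = 0, c2 = 0 & c3 = 0] by split; lra.
by case=> [[|[|[|[|//]]]] hi]; 
  [rewrite -z0|rewrite -z1|rewrite -z2|rewrite -z3]; congr c; exact: val_inj.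
Qed.

(** Edge [0 1] attains the lower bound, edge [2 3] the upper one. *)
Lemma family_dist_bounds u (k l : 'I_4) : 0 < u <= 1 -> k != l ->
  let d := sqdist (family_tetrahedron u k) (family_tetrahedron u l) in
  16 + 4 * u ^+ 2 <= d <= 64 + 9 * u ^+ 2.
Proof.
move=> /andP[u0 u1]; have t0 : 0 <= u ^+ 2 by exact: sqr_ge0.
have t1 : u ^+ 2 <= 1 by rewrite exprn_ile1// ltW.
rewrite family_has_tables; move: t0 t1; set t := u ^+ 2 => t0 t1.
case: k => [[|[|[|[|//]]]] /= ?]; case: l => [[|[|[|[|//]]]] /= ?] => // _;
  rewrite /entry /= -?[(Pos.to_nat _)%:~R]/(_%:R) ?pos_literalE; apply/andP; split; lra.
Qed.

(** A similarity preserves the ratio of the extreme squared edge lengths, here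
    [(64 + 9 u^2) / (16 + 4 u^2)], which determines [u^2]. *)
Lemma family_similar u v : 0 < u <= 1 -> 0 < v <= 1 ->
  similar_tetrahedra (family_tetrahedron u) (family_tetrahedron v) -> u = v.
Proof.
move=> u01 v01 [f [r r0 fr] fT].
have [u0 _] := andP u01; have [v0 _] := andP v01.
set P := family_tetrahedron u; set Q := family_tetrahedron v.
have fsq x y : sqdist (f x) (f y) = r ^+ 2 * sqdist x y.
  rewrite -[LHS]sqr_sqrtr ?sqdist_ge0// -[sqdist x y]sqr_sqrtr ?sqdist_ge0//.
  by rewrite -exprMn; congr (_ ^+ 2); exact: fr.
have q0 : 0 < r ^+ 2 by rewrite exprn_gt0.
have Pgt0 k l : k != l -> 0 < sqdist (P k) (P l).
  move=> kl; have /andP[+ _] := family_dist_bounds u01 kl; apply: lt_le_trans.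
  by rewrite ltr_wpDr ?ltr0n // mulr_ge0 ?sqr_ge0.
have Qgt0 k l : k != l -> 0 < sqdist (Q k) (Q l).
  move=> kl; have /andP[+ _] := family_dist_bounds v01 kl; apply: lt_le_trans.
  by rewrite ltr_wpDr ?ltr0n // mulr_ge0 ?sqr_ge0.
have fP k : exists k', f (P k) = Q k'.
  have : (range Q) (f (P k)) by rewrite -fT; exists (P k) => //; exists k.
  by case=> k' _ <-; exists k'.
have fQ k : exists k', Q k = f (P k').
  have : (range Q) (Q k) by exists k.
  by rewrite -fT => -[_ [k' _ <-] <-]; exists k'.
have img k l : k != l ->
    16 + 4 * v ^+ 2 <= r ^+ 2 * sqdist (P k) (P l) <= 64 + 9 * v ^+ 2.
  move=> kl; rewrite -fsq; have [k' hk] := fP k; have [l' hl] := fP l.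
  rewrite hk hl; apply: family_dist_bounds => //; apply/eqP => kl'.
  have := fsq (P k) (P l); rewrite hk hl kl' sqdistxx => /esym/eqP.
  by rewrite mulf_eq0 !gt_eqF ?Pgt0.
(* Edges of [Q] come from edges of [P]; together with [img] this forces the extremes to
   correspond. *)
have pre k l : k != l ->
    r ^+ 2 * (16 + 4 * u ^+ 2) <= sqdist (Q k) (Q l)
      <= r ^+ 2 * (64 + 9 * u ^+ 2).
  move=> kl; have [k' hk] := fQ k; have [l' hl] := fQ l.
  rewrite hk hl fsq !ler_pM2l//; apply: family_dist_bounds => //; apply/eqP => kl'.
  by have := Qgt0 _ _ kl; rewrite hk hl kl' sqdistxx ltxx.
have minmax w (x := family_tetrahedron w) :
    sqdist (x 0) (x 1) = 16 + 4 * w ^+ 2 /\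
    sqdist (x 2%:R) (x 3%:R) = 64 + 9 * w ^+ 2.
  split; rewrite family_has_tables /entry /=.
    by rewrite -[(Pos.to_nat 16)%:~R]/(16%:R) -[(Pos.to_nat 4)%:~R]/(4%:R); ring.
  by rewrite -[(Pos.to_nat 64)%:~R]/(64%:R) -[(Pos.to_nat 9)%:~R]/(9%:R); ring.
have [minP maxP] := minmax u; have [minQ maxQ] := minmax v.
have := img 0 1 isT; rewrite minP => /andP[h1 _].
have := img 2%:R 3%:R isT; rewrite maxP => /andP[_ h2].
have := pre 0 1 isT; rewrite minQ => /andP[h3 _].
have := pre 2%:R 3%:R isT; rewrite maxQ => /andP[_ h4].
have e1 : r ^+ 2 * (16 + 4 * u ^+ 2) = 16 + 4 * v ^+ 2 by apply/eqP; rewrite eq_le h1 h3.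
have e2 : r ^+ 2 * (64 + 9 * u ^+ 2) = 64 + 9 * v ^+ 2 by apply/eqP; rewrite eq_le h2 h4.
have e3 : (16 + 4 * v ^+ 2) * (64 + 9 * u ^+ 2) = (64 + 9 * v ^+ 2) * (16 + 4 * u ^+ 2).
  by rewrite -e1 -e2; ring.
(* The products [u^2 v^2] cancel in [e3], leaving [112 u^2 = 112 v^2]. *)
have /eqP : u ^+ 2 = v ^+ 2 by lra.
by rewrite eqrXn2 ?ltW// => /eqP.
Qed.

(** A countable set of reals has Lebesgue measure 0, but the parameter interval has measure 1; a
    coordinate of vertex 1 recovers [u]. *)
Lemma family_uncountable : ~ countable (family_tetrahedron @` `]0, 1]%classic).
Proof.
move=> cS.
have inj : {in `]0, 1]%classic &, injective family_tetrahedron}.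
  move=> u v _ _ /(congr1 (fun x : tetrahedron R => x 1 0 2%:R)).
  by rewrite !mxE /= => /mulfI; apply; rewrite pnatr_eq0.
have cI : countable (`]0, 1]%classic : set R).
  by rewrite -(eq_countable (inj_card_eq inj)).
have := countable_lebesgue_measure0 cI.
by rewrite /= lebesgue_measure_itv /= lte_fin ltr01 oppr0 adde0 => /eqP;
  rewrite eqe oner_eq0.
Qed.
End Family.

Theorem theorem1p2 (R : realType) :
  exists S : set (tetrahedron R),
    [/\ ~ countable S,
        forall T1 T2, S T1 -> S T2 -> T1 <> T2 -> ~ similar_tetrahedra T1 T2
      & forall T, S T ->
          nondegenerate_tetrahedron T /\
          exists D : nat -> tetrahedron R,
            [/\ LEB_branch T D,
                degenerates D
              & forall n, has_unique_longest_edge (D n)]].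
Proof.
exists (@family_tetrahedron R @` `]0, 1]%classic); split.
- exact: family_uncountable.
- move=> _ _ [u /= + <-] [v /= + <-]; rewrite !in_itv /= => u01 v01 uv.
  by move=> /(family_similar u01 v01) euv; apply: uv; rewrite euv.
move=> _ [u /= + <-]; rewrite in_itv /= => /andP[u0 u1].
have t01 : 0 < u ^+ 2 <= 1 by rewrite exprn_gt0// exprn_ile1// ltW.
have hT := family_has_tables u.
split; first exact: family_nondegenerate.
exists (branch (family_tetrahedron u)); split.
- exact: branch_LEB t01 hT.
- exact: branch_degenerates t01 hT.
- exact: branch_unique t01 hT.
Qed.
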